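(* Let $(X,\pi)$ be a weighted $n$-partite simplicial complex such that $\pi$ is $\vec\varepsilon$-product, $\vec\varepsilon=(\varepsilon_0,\dots,\varepsilon_{n-2})$. Then for every face $\alpha\in X$ and all nonempty disjoint $I,J\subseteq[n]\setminus\mathrm{typ}(\alpha)$, \[\sigma_2\big(C^{I\to J}_\alpha\big)^2\le 1-\prod_{p=0}^{|I|-1}\prod_{q=0}^{|J|-1}\big(1-\varepsilon_{|\alpha|+p+q}^2\big).\] In particular, for nonempty disjoint $I,J\subseteq[n]$, \[\big(\varepsilon^{I\to J}\big)^2\le 1-\prod_{p=0}^{|I|-1}\prod_{q=0}^{|J|-1}\big(1-\varepsilon^2_{n-|I|-|J|+p+q}\big).\]
   Context: An $n$-partite simplicial complex $X$ is a downward-closed family of subsets of a finite vertex set whose inclusion-maximal faces all have size $n$, with vertices partitioned into sides $X[1],\dots,X[n]$ such that each face $\omega\in X^{(n)}$ of size $n$ contains exactly one vertex $\omega_i$ per side. $\mathrm{typ}(\alpha)=\{i:\alpha\cap X[i]\neq\emptyset\}$, $|\alpha|$ the number of vertices of $\alpha$, $X[T]$ = faces of type $T$, $\alpha\oplus\beta$ = union of faces of disjoint types. $\pi$ is a full-support probability distribution on $X^{(n)}$. For a face $\alpha$ of type $S$ and $T\subseteq[n]\setminus S$: $X_\alpha[T]=\{\tau\in X[T]:\alpha\oplus\tau\in X\}$, $\pi^{(\alpha)}_T(\tau)=\Pr_{\omega\sim\pi}[\omega_T=\tau\mid\omega_S=\alpha]$. For disjoint $I,J\subseteq[n]\setminus\mathrm{typ}(\alpha)$,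 $C^{I\to J}_\alpha\in\mathbb R^{X_\alpha[I]\times X_\alpha[J]}$, $C^{I\to J}_\alpha(\tau_I,\tau_J)=\pi^{(\alpha\oplus\tau_I)}_J(\tau_J)$, and $\sigma_2(C^{I\to J}_\alpha)=\max\{\langle f,C^{I\to J}_\alpha g\rangle_{\pi^{(\alpha)}_I}:\|f\|_{\pi^{(\alpha)}_I}=\|g\|_{\pi^{(\alpha)}_J}=1,\ \langle f,\mathbf 1\rangle_{\pi^{(\alpha)}_I}=\langle g,\mathbf 1\rangle_{\pi^{(\alpha)}_J}=0\}$, where $\langle f,g\rangle_\mu=\sum_x\mu(x)f(x)g(x)$. $\varepsilon^{I\to J}=\max_{\alpha\in X[[n]\setminus(I\cup J)]}\sigma_2(C^{I\to J}_\alpha)$. $\pi$ is $\vec\varepsilon$-product if $\sigma_2(C^{\{i\}\to\{j\}}_\alpha)\le\varepsilon_{|\alpha|}$ for all faces $\alpha$ with $|\alpha|\le n-2$ and distinct $i,j\in[n]\setminus\mathrm{typ}(\alpha)$.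
   Formalization: The formal statement additionally assumes ε_k ≤ 1 for 0 ≤ k ≤ n−2; without it the claim fails, e.g. n=3, ε=(5,5), α=∅, |I|=2, |J|=1, where the right-hand side is 1−24² < 0. *)

(* Defs.v *)
From HB Require Import structures.
From mathcomp Require Import all_boot all_order all_algebra.
From mathcomp Require Import classical_sets reals.

Set Implicit Arguments.
Unset Strict Implicit.
Unset Printing Implicit Defensive.

Import Order.TTheory GRing.Theory Num.Theory.

Local Open Scope ring_scope.

(* The sides [n] = {1, ..., n} are indexed by 'I_n. *)
Record partite_complex (n : nat) (V : finType) := PartiteComplex {
  faces : {set {set V}};
  side : V -> 'I_n;
  faces_down : forall a b : {set V},
    b \subset a -> a \in faces -> b \in faces;
  faces_pure : forall a : {set V},
    maxset (fun b => b \in faces) a -> #|a| = n;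
  faces_partite : forall (w : {set V}) (i : 'I_n),
    w \in faces -> #|w| = n -> #|[set v in w | side v == i]| = 1%N
}.

Section Complex.
Variables (n : nat) (V : finType) (X : partite_complex n V).
Implicit Types (a t w : {set V}) (T : {set 'I_n}).

Definition facets : {set {set V}} := [set w in faces X | #|w| == n].

Definition typ a : {set 'I_n} := [set side X v | v in a].

Definition faces_of_type T : {set {set V}} := [set t in faces X | typ t == T].

Definition link_faces a T : {set {set V}} :=
  [set t in faces_of_type T | a :|: t \in faces X].

Definition proj w T : {set V} := [set v in w | side X v \in T].

End Complex.

(* Only the values of a weighting on the facets are relevant. *)
Record weighting (R : realType) (n : nat) (V : finType)
    (X : partite_complex n V) := Weighting {
  weight :> {set V} -> R;
  weight_gt0 : forall w, w \in facets X -> 0 < weight w;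
  weight_sum1 : \sum_(w in facets X) weight w = 1
}.

Section Weighted.
Variables (R : realType) (n : nat) (V : finType) (X : partite_complex n V).
Variable P : weighting R X.
Implicit Types (a t : {set V}) (I J T : {set 'I_n}) (f g : {set V} -> R).

Definition prob (E : pred {set V}) : R := \sum_(w in facets X | E w) P w.

(* Pr[w_T = t | w_S = a] with S = typ(a). *)
Definition cond_marginal a T t : R :=
  prob [pred w | (proj X w T == t) && (proj X w (typ X a) == a)]
  / prob [pred w | proj X w (typ X a) == a].

(* Elements of R^(X_a[T]) are represented by functions on all of {set V}, whose
   values outside X_a[T] are never read. *)
Definition inner a T f g : R :=
  \sum_(t in link_faces X a T) cond_marginal a T t * f t * g t.

Definition norm a T f : R := Num.sqrt (inner a T f f).

Definition colored_walk a I J (tI tJ : {set V}) : R :=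
  cond_marginal (a :|: tI) J tJ.

Definition walk_apply a I J g : {set V} -> R :=
  fun tI => \sum_(tJ in link_faces X a J) colored_walk a I J tI tJ * g tJ.

(* For a face a and disjoint I, J outside typ(a), this set is compact, so its
   supremum is a maximum whenever it is nonempty.  It is empty exactly when
   X_a[I] or X_a[J] is a singleton; then there is no second singular value and
   sup set0 = 0 gives sigma_2 = 0. *)
Definition sigma2 a I J : R :=
  sup [set r : R | exists f g : {set V} -> R,
    [/\ norm a I f = 1 /\ norm a J g = 1,
        inner a I f (fun=> 1) = 0, inner a J g (fun=> 1) = 0
      & r = inner a I f (walk_apply a I J g)]]%classic.

(* The default value 0 is harmless: sigma_2 is nonnegative, as its defining set
   is closed under negation. *)
Definition eps_walk I J : R :=
  \big[Num.max/0]_(a in faces_of_type X (~: (I :|: J))) sigma2 a I J.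

(* Only eps 0, ..., eps (n - 2) are constrained. *)
Definition eps_product (eps : nat -> R) : Prop :=
  forall a, a \in faces X -> (#|a| + 2 <= n)%N ->
  forall i j : 'I_n, i != j -> i \notin typ X a -> j \notin typ X a ->
  sigma2 a [set i]%SET [set j]%SET <= eps #|a|.

End Weighted.

(* Main.v *)
(* The bound [sigma_2(C^{I->J}_a)^2 <= 1 - c] is equivalent to the variance
   inequality [E Var(f(w_I) | w_J) >= c Var f(w_I)], under the law of [w]
   conditioned on containing [a].  By the law of total variance the constants
   [c] multiply when [J] is revealed in two steps, the second one in the links of
   the faces revealed in the first.  Hence revealing [J] one side at a time gives
   the bound for [{i}->J]; since the bound is symmetric in [I] and [J], the same
   argument then handles the sides of [I] one at a time. *)
Require Import Defs.
From mathcomp Require Import classical_sets.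
From mathcomp Require Import all_boot all_order all_algebra.
From mathcomp Require Import reals ring lra.

Import Order.TTheory GRing.Theory Num.Theory.

Local Open Scope ring_scope.

Set Implicit Arguments.
Unset Strict Implicit.
Unset Printing Implicit Defensive.

Lemma disjoint_setU (T : finType) (A B C : {set T}) :
  [disjoint A :|: B & C] = [disjoint A & C] && [disjoint B & C].
Proof. by rewrite !disjoints_subset subUset. Qed.

(** * Faces, their types and their projections *)

Section Faces.
Variables (n : nat) (V : finType) (X : partite_complex n V).
Implicit Types (a b t w : {set V}) (S T : {set 'I_n}).

Lemma facet_face w : w \in facets X -> w \in faces X.
Proof. by rewrite inE => /andP[]. Qed.

Lemma proj_sub w T : proj X w T \subset w.
Proof. by apply/subsetP => v; rewrite inE => /andP[]. Qed.

Lemma proj_face w T : w \in facets X -> proj X w T \in faces X.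
Proof. by move=> /facet_face; apply: faces_down; apply: proj_sub. Qed.

Lemma projU w S T : proj X w (S :|: T) = proj X w S :|: proj X w T.
Proof. by apply/setP => v; rewrite !inE andb_orr. Qed.

Lemma facet_side1 w i :
  w \in facets X -> exists v, [set u in w | side X u == i] = [set v].
Proof.
rewrite inE => /andP[wX /eqP wn]; apply/cards1P.
by rewrite (faces_partite i wX wn).
Qed.

Lemma side_inj w : w \in facets X -> {in w &, injective (side X)}.
Proof.
move=> wX u v uw vw uv; have [x Hx] := facet_side1 (side X v) wX.
have: u \in [set x] by rewrite -Hx inE uw uv eqxx.
have: v \in [set x] by rewrite -Hx inE vw eqxx.
by rewrite !inE => /eqP -> /eqP.
Qed.

Lemma typ_proj w T : w \in facets X -> typ X (proj X w T) = T.
Proof.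
move=> wX; apply/setP => i; apply/imsetP/idP => [[v]|iT].
  by rewrite inE => /andP[_ ?] ->.
have [x /setP/(_ x)] := facet_side1 i wX.
rewrite !inE eqxx => /andP[xw /eqP xi].
by exists x => //; rewrite inE xw xi.
Qed.

Lemma typU a b : typ X (a :|: b) = typ X a :|: typ X b.
Proof. by rewrite /typ imsetU. Qed.

Lemma face_sub_facet a : a \in faces X -> exists2 w, w \in facets X & a \subset w.
Proof.
move=> aX; have [w wmax aw] := @maxset_exists _ (fun b => b \in faces X) a aX.
exists w => //; rewrite inE (faces_pure wmax) eqxx andbT.
by case/maxsetP: wmax.
Qed.

(** A facet has only one vertex on each side. This turns conditioning on [w_S = a] into the simpler
    event that [w] contains [a]. *)
Lemma proj_eq w t : w \in facets X -> (proj X w (typ X t) == t) = (t \subset w).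
Proof.
move=> wX; apply/eqP/idP => [<-|tw]; first exact: proj_sub.
apply/setP => v; rewrite inE; apply/andP/idP => [[vw /imsetP[u ut vu]]|vt].
  by rewrite (side_inj wX vw (subsetP tw u ut) vu).
by split; [exact: (subsetP tw) | exact: imset_f].
Qed.

Lemma card_face a : a \in faces X -> #|typ X a| = #|a|.
Proof.
move=> /face_sub_facet[w wX aw]; apply: card_in_imset => u v ua va.
by apply: (side_inj wX); apply: (subsetP aw).
Qed.

Lemma card_proj w T : w \in facets X -> #|proj X w T| = #|T|.
Proof. by move=> wX; rewrite -card_face ?proj_face // typ_proj. Qed.

Lemma link_facesP a T t :
  t \in link_faces X a T -> typ X t = T /\ a :|: t \in faces X.
Proof. by rewrite inE => /andP[]; rewrite inE => /andP[_ /eqP]. Qed.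

Lemma proj_link a w T :
  w \in facets X -> a \subset w -> proj X w T \in link_faces X a T.
Proof.
move=> wX aw; rewrite !inE proj_face // typ_proj // eqxx /=.
apply: faces_down (facet_face wX).
by rewrite subUset aw proj_sub.
Qed.

Lemma card_link a T t : a \in faces X -> [disjoint typ X a & T] ->
  t \in link_faces X a T -> #|a :|: t| = (#|a| + #|T|)%N.
Proof.
move=> aX dT /link_facesP[tT atX].
by rewrite -card_face // typU tT cardsU disjoint_setI0 // cards0 subn0 card_face.
Qed.

Lemma card_typ_le a T : a \in faces X -> [disjoint typ X a & T] ->
  (#|a| + #|T| <= n)%N.
Proof.
move=> aX dI; rewrite -(card_face aX); move: (max_card (mem (typ X a :|: T))).
by rewrite card_ord cardsU disjoint_setI0 // cards0 subn0.
Qed.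

End Faces.

(** * Two inequalities over ordered fields *)

Lemma prodr_itv (R : numDomainType) m (F : nat -> R) : (forall k, (k < m)%N -> 0 <= F k <= 1) ->
  0 <= \prod_(0 <= k < m) F k <= 1.
Proof.
move=> h; rewrite big_mkord; apply: (big_ind (fun x => 0 <= x <= 1)) => [||k _].
- by rewrite ler01 lexx.
- by move=> x y /andP[x0 x1] /andP[y0 y1]; rewrite mulr_ge0 ?mulr_ile1.
- exact/h/ltn_ord.
Qed.

Lemma discriminant_le (R : realFieldType) (x y z : R) : 0 <= y ->
  (forall t, 0 <= x - 2 * t * z + t ^+ 2 * y) -> z ^+ 2 <= x * y.
Proof.
rewrite le_eqVlt => /orP[/eqP <-|y0] h.
  have [->|z0] := eqVneq z 0; first by rewrite expr0n mulr0.
  (* For [y = 0] the expression is affine in [t]; this [t] gives it the value -1. *)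
  have := h ((x + 1) / (2 * z)).
  have -> : 2 * ((x + 1) / (2 * z)) * z = x + 1 by field.
  by rewrite mulr0; lra.
(* The minimiser of the quadratic. *)
have := h (z / y).
have -> : x - 2 * (z / y) * z + (z / y) ^+ 2 * y = (x * y - z ^+ 2) / y.
  by field; rewrite gt_eqF.
by rewrite pmulr_lge0 ?invr_gt0 // subr_ge0.
Qed.

(** * Conditional expectations given a face *)

Section Expectation.
Variables (R : realType) (n : nat) (V : finType) (X : partite_complex n V).
Variable P : weighting R X.
Implicit Types (a b t w : {set V}) (I J T : {set 'I_n}) (f g F G : {set V} -> R).

(** The conditional expectation given [a], left unnormalised so that it is additive over the ways of
    extending [a]. *)
Definition mass a F : R := \sum_(w in facets X | a \subset w) P w * F w.

Definition mean a F : R := mass a F / mass a (fun=> 1).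

(** Lifts functions of the [I]-part and of the [J]-part to one space, that of the facets. *)
Definition on T f : {set V} -> R := fun w => f (proj X w T).

Lemma eq_mass a F G :
  (forall w, w \in facets X -> a \subset w -> F w = G w) -> mass a F = mass a G.
Proof. by move=> FG; apply: eq_bigr => w /andP[wX aw]; rewrite FG. Qed.

Lemma mass_ge0 a F : (forall w, 0 <= F w) -> 0 <= mass a F.
Proof.
by move=> F0; apply: sumr_ge0 => w /andP[wX _]; rewrite mulr_ge0 // ltW // weight_gt0.
Qed.

Lemma massD a F G : mass a (fun w => F w + G w) = mass a F + mass a G.
Proof. by rewrite -big_split; apply: eq_bigr => w _; rewrite mulrDr. Qed.

Lemma massZ a k F : mass a (fun w => k * F w) = k * mass a F.
Proof. by rewrite mulr_sumr; apply: eq_bigr => w _; rewrite mulrCA. Qed.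

Lemma mass_cst a k : mass a (fun=> k) = k * mass a (fun=> 1).
Proof. by rewrite -massZ; apply: eq_bigr => w _; rewrite mulr1. Qed.

Lemma mass1_gt0 a : a \in faces X -> 0 < mass a (fun=> 1).
Proof.
case/face_sub_facet => w wX aw; rewrite /mass (bigD1 w) ?wX //= mulr1.
rewrite ltr_pwDl ?weight_gt0 //; apply: sumr_ge0 => u /andP[/andP[uX _] _].
by rewrite mulr1 ltW // weight_gt0.
Qed.

Lemma mass_center a F : a \in faces X -> mass a (fun w => F w - mean a F) = 0.
Proof.
move=> aX; rewrite massD mass_cst mulNr divfK ?subrr //.
by rewrite gt_eqF // mass1_gt0.
Qed.

Lemma mass_sqrB a F G k :
  mass a (fun w => (F w - k * G w) ^+ 2) =
  mass a (fun w => F w ^+ 2) - 2 * k * mass a (fun w => F w * G w)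
  + k ^+ 2 * mass a (fun w => G w ^+ 2).
Proof. by rewrite -mulNr -!massZ -!massD; apply: eq_mass => w _ _; ring. Qed.

Lemma mass_sqrDcst a F k : mass a F = 0 ->
  mass a (fun w => (F w + k) ^+ 2) =
  mass a (fun w => F w ^+ 2) + k ^+ 2 * mass a (fun=> 1).
Proof.
move=> F0; rewrite -(mass_cst a (k ^+ 2)) -[LHS]addr0 -(mulr0 (- (2 * k))) -F0.
by rewrite -massZ -!massD; apply: eq_mass => w _ _; ring.
Qed.

Lemma mass_CauchySchwarz a F G :
  mass a (fun w => F w * G w) ^+ 2 <=
  mass a (fun w => F w ^+ 2) * mass a (fun w => G w ^+ 2).
Proof.
apply: discriminant_le => [|k]; first by apply: mass_ge0 => w; apply: sqr_ge0.
by rewrite -mass_sqrB; apply: mass_ge0 => w; apply: sqr_ge0.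
Qed.

(** Sorts the facets containing [b] by their [T]-part. The index set is the link of [a], not of [b],
    to match the sum in [walk_apply]; a [t] incompatible with [b] contributes an empty sum. *)
Lemma mass_split a b T F : a \subset b ->
  mass b F = \sum_(t in link_faces X a T) mass (b :|: t) F.
Proof.
move=> ab; rewrite /mass.
rewrite (partition_big (fun w => proj X w T) (fun t => t \in link_faces X a T)) /=.
  apply: eq_bigr => t /link_facesP[<- _]; apply: eq_bigl => w.
  case wX : (w \in facets X) => //=.
  by rewrite subUset proj_eq.
by move=> w /andP[wX bw]; rewrite proj_link // (subset_trans ab).
Qed.

(** The two arguments of [h] allow the [T]-part to be frozen in one place while other occurrences of
    [w] stay free. *)
Lemma mass_on a b T h : typ X b = T ->
  mass (a :|: b) (fun w => h w (proj X w T)) = mass (a :|: b) (fun w => h w b).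
Proof.
move=> bT; apply: eq_mass => w wX; rewrite subUset => /andP[_ bw].
by move: bw; rewrite -(proj_eq _ wX) bT => /eqP ->.
Qed.

(** * Inner products and walks as expectations *)

Lemma prob_mass a : prob P (fun w => a \subset w) = mass a (fun=> 1).
Proof. by apply: eq_bigr => w _; rewrite mulr1. Qed.

Lemma cond_marginalE a T t : typ X t = T ->
  cond_marginal P a T t = mass (a :|: t) (fun=> 1) / mass a (fun=> 1).
Proof.
move=> <-; rewrite /cond_marginal -!prob_mass; congr (_ / _).
  apply: eq_bigl => w /=; case wX : (w \in facets X) => //=.
  by rewrite subUset !proj_eq // andbC.
by apply: eq_bigl => w /=; case wX : (w \in facets X) => //=; rewrite proj_eq.
Qed.

Lemma innerE a T f g :
  inner P a T f g = mean a (fun w => on T f w * on T g w).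
Proof.
rewrite /mean (mass_split T _ (subxx a)) mulr_suml.
apply: eq_bigr => t /link_facesP[tT _].
rewrite cond_marginalE // (mass_on _ (fun _ x => f x * g x)) // (mass_cst _ (f t * _)).
ring.
Qed.

Lemma walk_applyE a I J g t : t \in link_faces X a I ->
  walk_apply P a I J g t = mean (a :|: t) (on J g).
Proof.
move=> /link_facesP[tI atX].
rewrite /mean (mass_split J _ (subsetUl a t)) mulr_suml.
apply: eq_bigr => s /link_facesP[sJ _].
rewrite /colored_walk cond_marginalE // (mass_on _ (fun _ x => g x)) // (mass_cst _ (g s)).
ring.
Qed.

(** The tower property. The right-hand side exhibits the symmetry between [I] and [J]. *)
Lemma inner_walkE a I J f g :
  inner P a I f (walk_apply P a I J g) = mean a (fun w => on I f w * on J g w).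
Proof.
rewrite /mean (mass_split I _ (subxx a)) mulr_suml.
apply: eq_bigr => t tl; have [tI atX] := link_facesP tl.
rewrite cond_marginalE // walk_applyE // (mass_on _ (fun w x => f x * on J g w)) //.
rewrite massZ /mean; have := mass1_gt0 atX; move=> /lt0r_neq0 h.
move: (mass _ (fun=> 1)) h (_^-1) => x x0 y.
by rewrite mulrA; field.
Qed.


Lemma norm_eq1 a T f : a \in faces X ->
  norm P a T f = 1 <-> mass a (fun w => on T f w ^+ 2) = mass a (fun=> 1).
Proof.
move=> aX; have N0 := mass1_gt0 aX.
set x := mass a (fun w => on T f w ^+ 2).
have -> : norm P a T f = Num.sqrt (x / mass a (fun=> 1)) by rewrite /norm innerE.
have x0 : 0 <= x by apply: mass_ge0 => w; apply: sqr_ge0.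
split=> [/(congr1 (fun y => y ^+ 2))|->]; last by rewrite divff ?sqrtr1 ?gt_eqF.
rewrite sqr_sqrtr ?divr_ge0 ?(ltW N0) // expr1n => /(congr1 ( *%R^~ (mass a (fun=> 1)))).
by rewrite divfK ?gt_eqF // mul1r.
Qed.

Lemma inner_cst1 a T f : a \in faces X ->
  inner P a T f (fun=> 1) = 0 <-> mass a (on T f) = 0.
Proof.
move=> aX; have N0 := mass1_gt0 aX.
rewrite innerE /mean (@eq_mass _ _ (on T f)) => [|w _ _]; last by rewrite [X in _ * X]/on mulr1.
split=> [/eqP|->]; last by rewrite mul0r.
by rewrite mulf_eq0 invr_eq0 (gt_eqF N0) orbF => /eqP.
Qed.

(** * The second singular value as a maximal correlation *)

Lemma sigma2_sup a I J : a \in faces X ->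
  sigma2 P a I J = sup [set r : R | exists f g,
    [/\ mass a (fun w => on I f w ^+ 2) = mass a (fun=> 1),
        mass a (fun w => on J g w ^+ 2) = mass a (fun=> 1),
        mass a (on I f) = 0, mass a (on J g) = 0
      & r = mean a (fun w => on I f w * on J g w)]]%classic.
Proof.
move=> aX; congr (sup _); apply/seteqP; split=> r /= [f [g]].
  case=> -[f1 g1] f0 g0 ->; exists f, g; split; last exact: inner_walkE.
  - exact/norm_eq1.
  - exact/norm_eq1.
  - exact/inner_cst1.
  - exact/inner_cst1.
case=> f1 g1 f0 g0 ->; exists f, g; split; last by rewrite inner_walkE.
- by split; apply/norm_eq1.
- exact/inner_cst1.
- exact/inner_cst1.
Qed.

Lemma normr_mean_le_sigma2 a I J f g : a \in faces X ->
  mass a (fun w => on I f w ^+ 2) = mass a (fun=> 1) ->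
  mass a (fun w => on J g w ^+ 2) = mass a (fun=> 1) ->
  mass a (on I f) = 0 -> mass a (on J g) = 0 ->
  `|mean a (fun w => on I f w * on J g w)| <= sigma2 P a I J.
Proof.
move=> aX f1 g1 f0 g0; rewrite sigma2_sup //; set S := (X in sup X).
(* By Cauchy-Schwarz. Without boundedness [sup] need not be an upper bound. *)
have S1 : ubound S 1.
  move=> r [f' [g' [f1' g1' _ _ ->]]]; have N0 := mass1_gt0 aX.
  rewrite /mean ler_pdivrMr // mul1r; apply: le_trans (ler_norm _) _.
  rewrite -ler_sqr ?nnegrE ?(ltW N0) ?normr_ge0 // real_normK ?num_real // [leRHS]expr2.
  by rewrite -{1}f1' -g1' mass_CauchySchwarz.
have Sr : S (mean a (fun w => on I f w * on J g w)) by exists f, g.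
(* Replacing [f] by its opposite shows that the set is closed under negation, whence the absolute
   value. *)
have SNr : S (- mean a (fun w => on I f w * on J g w)).
  exists (fun t => -1 * f t), g; split=> //.
  - by rewrite -f1; apply: eq_mass => w _ _; rewrite /on; ring.
  - by rewrite /on massZ f0 mulr0.
  - rewrite /mean -mulNr; congr (_ / _); rewrite -mulN1r -massZ.
    by apply: eq_mass => w _ _; rewrite /on mulrA.
have Sub : has_ubound S by exists 1.
by rewrite ler_norml lerNl !ub_le_sup.
Qed.

Lemma sigma2_ge0 a I J : a \in faces X -> 0 <= sigma2 P a I J.
Proof.
move=> aX; rewrite sigma2_sup //; set S := (X in sup X).
have [->|/set0P[r [f [g [f1 g1 f0 g0 _]]]]] := eqVneq S classical_sets.set0.
  by rewrite sup0.
rewrite -sigma2_sup //.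
by apply: le_trans (normr_mean_le_sigma2 aX f1 g1 f0 g0); apply: normr_ge0.
Qed.

(** The homogeneous form of [sigma2 ^+ 2 <= s]: no supremum and no normalisation of [f] and [g].
    Both sides have degree two in [mass], so its normalising factor cancels. *)
Definition correlation_le a I J s := forall f g,
  mass a (on I f) = 0 -> mass a (on J g) = 0 ->
  mass a (fun w => on I f w * on J g w) ^+ 2 <=
  s * mass a (fun w => on I f w ^+ 2) * mass a (fun w => on J g w ^+ 2).

Lemma correlation_leC a I J s : correlation_le a I J s -> correlation_le a J I s.
Proof.
move=> h f g f0 g0; rewrite (@eq_mass _ _ (fun w => on I g w * on J f w)).
  by rewrite mulrAC; apply: h.
by move=> w _ _; rewrite mulrC.
Qed.

Lemma correlation_le_sigma2 a I J : a \in faces X ->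
  correlation_le a I J (sigma2 P a I J ^+ 2).
Proof.
move=> aX f g f0 g0; have N0 := mass1_gt0 aX.
have CS := mass_CauchySchwarz a (on I f) (on J g).
set x := mass a (fun w => on I f w ^+ 2) in CS *.
set y := mass a (fun w => on J g w ^+ 2) in CS *.
have x0 : 0 <= x by apply: mass_ge0 => w; apply: sqr_ge0.
have y0 : 0 <= y by apply: mass_ge0 => w; apply: sqr_ge0.
(* If [f] or [g] has norm zero it cannot be rescaled, but then Cauchy-Schwarz makes the left-hand
   side vanish. *)
have [xy0|xy0] := eqVneq (x * y) 0.
  by rewrite -mulrA xy0 mulr0; rewrite xy0 in CS.
have [xn0 yn0] : x != 0 /\ y != 0 by move: xy0; rewrite mulf_eq0 negb_or => /andP.
set N := mass a (fun=> 1) in N0.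
(* Norm 1 means that the unnormalised square is [N], hence the factor [Num.sqrt (N / z)]. *)
have kE z h T : 0 <= z -> z != 0 -> mass a (fun w => on T h w ^+ 2) = z ->
    mass a (fun w => on T (fun t => Num.sqrt (N / z) * h t) w ^+ 2) = N.
  move=> z0 zn0 hz; transitivity (Num.sqrt (N / z) ^+ 2 * z).
    by rewrite -{3}hz -massZ; apply: eq_mass => w _ _; rewrite /on exprMn.
  by rewrite sqr_sqrtr ?divfK // divr_ge0 // ltW.
have k0 k h T : mass a (on T h) = 0 -> mass a (on T (fun t => k * h t)) = 0.
  by move=> h0; rewrite /on massZ [mass _ _]h0 mulr0.
have := normr_mean_le_sigma2 aX (kE _ _ _ x0 xn0 erefl) (kE _ _ _ y0 yn0 erefl)
  (k0 _ _ _ f0) (k0 _ _ _ g0).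
rewrite /mean (@eq_mass _ _ (fun w => (Num.sqrt (N / x) * Num.sqrt (N / y)) *
  (on I f w * on J g w))) => [|w _ _]; last by rewrite /on mulrACA.
rewrite massZ; set z := mass a _ => zs.
have s0 := sigma2_ge0 I J aX.
have {zs} : (Num.sqrt (N / x) * Num.sqrt (N / y) * z / N) ^+ 2 <= sigma2 P a I J ^+ 2.
  by rewrite -real_normK ?num_real // ler_sqr ?nnegrE ?normr_ge0.
rewrite !exprMn !sqr_sqrtr ?divr_ge0 ?(ltW N0) //.
have -> : N / x * (N / y) * z ^+ 2 * N^-1 ^+ 2 = z ^+ 2 / (x * y).
  by field; rewrite xn0 yn0 gt_eqF.
by rewrite ler_pdivrMr ?mulrA // lt0r xy0 mulr_ge0.
Qed.

Lemma sigma2_sqr_le a I J s : a \in faces X -> 0 <= s ->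
  correlation_le a I J s -> sigma2 P a I J ^+ 2 <= s.
Proof.
move=> aX s0 h; rewrite -(sqr_sqrtr s0) ler_sqr ?nnegrE ?sqrtr_ge0 ?sigma2_ge0 //.
rewrite sigma2_sup //; set S := (X in sup X).
have Sub : ubound S (Num.sqrt s).
  move=> r [f [g [f1 g1 f0 g0 ->]]]; have N0 := mass1_gt0 aX.
  apply: le_trans (ler_norm _) _.
  rewrite -ler_sqr ?nnegrE ?sqrtr_ge0 ?normr_ge0 // real_normK ?num_real // sqr_sqrtr //.
  rewrite /mean expr_div_n ler_pdivrMr ?exprn_gt0 // expr2 mulrA.
  by rewrite -{1}f1 -g1; apply: h.
(* [ge_sup] requires a nonempty set; for the empty one [sup] takes its default value 0. *)
have [->|/set0P S0] := eqVneq S classical_sets.set0; last exact: ge_sup.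
by rewrite sup0 sqrtr_ge0.
Qed.

(** * Variance inequalities *)

(* The right-hand side is minimised over [g] by the conditional expectation of
   [f] given the [J]-part, so this says that the conditional variance is on
   average at least [c] times the variance.  Quantifying over [g] instead
   avoids conditional expectations. *)
Definition variance_ge a I J c := forall f g,
  c * mass a (fun w => (on I f w - mean a (on I f)) ^+ 2) <=
  mass a (fun w => (on I f w - on J g w) ^+ 2).

(** Testing the variance inequality on all multiples [k * g] gives a nonnegative quadratic in [k],
    whose discriminant is the claim. *)
Lemma variance_ge_correlation a I J c : a \in faces X ->
  variance_ge a I J c -> correlation_le a I J (1 - c).
Proof.
move=> aX h f g f0 g0; apply: discriminant_le.
  by apply: mass_ge0 => w; apply: sqr_ge0.
move=> k; have := h f (fun t => k * g t).
rewrite [on J _]/on (mass_sqrB a (on I f) (on J g) k) {1}/mean f0 mul0r.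
rewrite (@eq_mass _ _ (fun w => on I f w ^+ 2)) => [|w _ _]; last by rewrite subr0.
lra.
Qed.

(** After [f] and [g] are centred, the cross term is absorbed by the inequality of arithmetic and
    geometric means, applied to [(1 - c) * x] and [y]; [c <= 1] makes the first nonnegative. *)
Lemma correlation_variance_ge a I J c : a \in faces X -> c <= 1 ->
  correlation_le a I J (1 - c) -> variance_ge a I J c.
Proof.
move=> aX c1 h f g; set mf := mean a (on I f); pose mg := mean a (on J g).
have := h (fun t => f t - mf) (fun t => g t - mg) (mass_center _ aX) (mass_center _ aX).
rewrite (_ : on I (fun t => f t - mf) = fun w => on I f w - mf) //.
rewrite (_ : on J (fun t => g t - mg) = fun w => on J g w - mg) //.
have f0 : mass a (fun w => on I f w - mf) = 0 by apply: mass_center.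
have g0 : mass a (fun w => on J g w - mg) = 0 by apply: mass_center.
pose F w := on I f w - mf; pose G w := on J g w - mg.
have FG0 : mass a (fun w => F w - 1 * G w) = 0.
  have -> : mass a (fun w => F w - 1 * G w) = mass a F - 1 * mass a G.
    by rewrite -mulNr -massZ -massD; apply: eq_mass => w _ _; rewrite mulNr.
  by rewrite [mass a F]f0 [mass a G]g0 mulr0 subr0.
(* The difference of the means splits off as a nonnegative term. The factor 1 is the [k] of
   [mass_sqrB]. *)
have -> : mass a (fun w => (on I f w - on J g w) ^+ 2) =
  mass a (fun w => (F w - 1 * G w) ^+ 2) + (mf - mg) ^+ 2 * mass a (fun=> 1).
  by rewrite -mass_sqrDcst //; apply: eq_mass => w _ _; rewrite /F /G; ring.
rewrite mass_sqrB -/F -/G.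
have x0 : 0 <= mass a (fun w => F w ^+ 2) by apply: mass_ge0 => w; apply: sqr_ge0.
have y0 : 0 <= mass a (fun w => G w ^+ 2) by apply: mass_ge0 => w; apply: sqr_ge0.
have : 0 <= (mf - mg) ^+ 2 * mass a (fun=> 1).
  by rewrite mulr_ge0 ?sqr_ge0 // ltW // mass1_gt0.
move: (_ * mass a (fun=> 1)) x0 y0; rewrite /F /G.
set x := mass a _; set y := mass a _; set z := mass a _ => v x0 y0 v0 zxy.
suff : 2 * z <= (1 - c) * x + y by lra.
have s0 : 0 <= (1 - c) * x by rewrite mulr_ge0 // subr_ge0.
apply: le_trans (ler_norm _) _.
rewrite -ler_sqr ?nnegrE ?normr_ge0 ?addr_ge0 // real_normK ?num_real // exprMn.
apply: (@le_trans _ _ (4 * ((1 - c) * x * y))).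
  by rewrite -natrX ler_pM2l.
by rewrite -subr_ge0 (_ : _ - _ = ((1 - c) * x - y) ^+ 2) ?sqr_ge0 //; ring.
Qed.

Lemma variance_geC a I J c : a \in faces X -> c <= 1 ->
  variance_ge a I J c -> variance_ge a J I c.
Proof.
move=> aX c1 /variance_ge_correlation h; apply: correlation_variance_ge => //.
exact/correlation_leC/h.
Qed.

(** A function of the empty part is a constant, and the mean is the best constant approximation.
    This starts both inductions below, where the product is empty. *)
Lemma variance_ge_set0 a I : a \in faces X -> variance_ge a I finset.set0 1.
Proof.
move=> aX f g; rewrite mul1r; set m := mean a _.
have pE w : proj X w finset.set0 = finset.set0 by apply/setP => v; rewrite !inE andbF.
have -> : mass a (fun w => (on I f w - on finset.set0 g w) ^+ 2) =
  mass a (fun w => ((on I f w - m) + (m - g finset.set0)) ^+ 2).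
  by apply: eq_mass => w _ _; rewrite /on pE; ring.
rewrite (mass_sqrDcst _ (mass_center (on I f) aX)) lerDl mulr_ge0 ?sqr_ge0 //.
by rewrite ltW // mass1_gt0.
Qed.

(* Law of total variance: reveal the [J]-part first, then the [K]-part. *)
Lemma variance_geU a I J K c d : 0 <= d ->
  variance_ge a I J c ->
  (forall t, t \in link_faces X a J -> variance_ge (a :|: t) I K d) ->
  variance_ge a I (J :|: K) (c * d).
Proof.
move=> d0 hJ hK f g; pose m t := mean (a :|: t) (on I f).
(* The conditional mean [m] is itself a function of the [J]-part, so [hJ] applies to it. *)
apply: (@le_trans _ _ (d * mass a (fun w => (on I f w - on J m w) ^+ 2))).
  by rewrite mulrAC mulrC ler_wpM2l.
rewrite !(mass_split J _ (subxx a)) mulr_sumr; apply: ler_sum => t tl.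
have [tJ _] := link_facesP tl.
rewrite (mass_on _ (fun w x => (on I f w - m x) ^+ 2)) //.
(* Once the [J]-part is fixed to [t], [m t] is the mean in the link of [t], and [g] depends on the
   [K]-part alone. *)
apply: le_trans (hK t tl f (fun x => g (t :|: x))) _.
rewrite le_eqVlt; apply/orP; left; apply/eqP.
rewrite -(mass_on _ (fun w x => (on I f w - g (x :|: proj X w K)) ^+ 2) tJ).
by apply: eq_mass => w _ _; rewrite /on projU.
Qed.

End Expectation.

(** * Induction on the sides *)

Section Product.
Variables (R : realType) (n : nat) (V : finType) (X : partite_complex n V).
Variables (P : weighting R X) (eps : nat -> R).
Hypothesis eps_le1 : forall k : nat, (k + 2 <= n)%N -> eps k <= 1.
Hypothesis P_eps : eps_product P eps.
Implicit Types (a t : {set V}) (I J : {set 'I_n}).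

Lemma exists_facet : exists w, w \in facets X.
Proof.
have [w wX|f0] := pickP (mem (facets X)); first by exists w.
have := weight_sum1 P; rewrite big_pred0 // => /eqP.
by rewrite eq_sym oner_eq0.
Qed.

(** [eps k] dominates some [sigma2]: project a facet to the first [k] sides and take the next two
    sides for [i] and [j]. *)
Lemma eps_ge0 k : (k + 2 <= n)%N -> 0 <= eps k.
Proof.
move=> kn; have [w wX] := exists_facet.
have k0n : (k < n)%N by rewrite (leq_trans _ kn) // addn2.
have k1n : (k.+1 < n)%N by rewrite (leq_trans _ kn) // addn2.
pose T := [set i : 'I_n | (i < k)%N]%SET.
have kT : #|T| = k.
  by rewrite -sum1dep_card (big_ord_narrow (ltnW k0n)) sum1_card card_ord.
have := P_eps (proj_face T wX) _ (i := Ordinal k0n) (j := Ordinal k1n).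
rewrite card_proj // kT typ_proj // !inE ltnn ltnNge leqnSn => /(_ kn).
rewrite -val_eqE /= neq_ltn ltnSn => /(_ isT isT isT).
by apply: le_trans; apply: sigma2_ge0; apply: proj_face.
Qed.

(** The lower end lets constants be multiplied in [variance_geU]; the upper end lets correlation
    bounds be turned back into variance inequalities. *)
Lemma eps_sqr_itv k : (k + 2 <= n)%N -> 0 <= 1 - eps k ^+ 2 <= 1.
Proof.
move=> kn; rewrite subr_ge0 gerBl sqr_ge0 andbT.
by rewrite expr_le1 ?eps_ge0 ?eps_le1.
Qed.

Lemma variance_ge11 a (i j : 'I_n) : a \in faces X -> (#|a| + 2 <= n)%N ->
  i != j -> i \notin typ X a -> j \notin typ X a ->
  variance_ge P a [set i]%SET [set j]%SET (1 - eps #|a| ^+ 2).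
Proof.
move=> aX an ij ia ja; apply: correlation_variance_ge => //.
  by case/andP: (eps_sqr_itv an).
move=> f g f0 g0; apply: le_trans (correlation_le_sigma2 aX f0 g0) _.
rewrite subKr.
do 2![apply: ler_wpM2r; first by apply: mass_ge0 => w; apply: sqr_ge0].
by rewrite ler_sqr ?nnegrE ?sigma2_ge0 ?eps_ge0 ?P_eps.
Qed.

Lemma variance_ge1 a i J : a \in faces X ->
  i \notin typ X a -> i \notin J -> [disjoint typ X a & J] ->
  variance_ge P a [set i]%SET J (\prod_(0 <= q < #|J|) (1 - eps (#|a| + q)%N ^+ 2)).
Proof.
move=> aX ia; move: {2}#|J| (erefl #|J|) => m; elim: m J => [|m IH] J Jm iJ aJ.
  by rewrite (cards0_eq Jm) cards0 big_nil; apply: variance_ge_set0.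
have /set0Pn[j jJ] : J != finset.set0 by rewrite -card_gt0 Jm.
have Km : #|J :\ j| = m by move: Jm; rewrite (cardsD1 j) jJ => -[].
have aK : [disjoint typ X a & J :\ j] by apply: disjointWr aJ; apply: subD1set.
have ij : i != j by apply: contraNneq iJ => ->.
have iK : i \notin J :\ j by rewrite !inE (negbTE iJ) andbF.
(* The sides of [a], the [m] sides already revealed, [i] and [j] are all distinct. *)
have an : (#|a| + m + 2 <= n)%N.
  have := @card_typ_le _ _ _ a (i |: J) aX; rewrite cardsU1 iJ Jm => h.
  rewrite -addnA addn2; apply: h; rewrite disjoint_sym disjoint_setU disjoints1 ia.
  by rewrite disjoint_sym.
(* The side [j] is revealed last, in the link of a face of size [#|a| + m]; this gives the last
   factor of the product. *)
rewrite Jm big_nat_recr //= -{1}(setD1K jJ) setUC; apply: variance_geU => //.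
- by case/andP: (eps_sqr_itv an).
- by rewrite -Km; apply: IH.
move=> t tl; have [tK atX] := link_facesP tl.
have atm := card_link aX aK tl; rewrite Km in atm.
rewrite -atm in an *; apply: variance_ge11 => //.
  by rewrite typU tK in_setU negb_or ia iK.
by rewrite typU tK !inE eqxx orbF (disjointFl aJ jJ).
Qed.

Lemma variance_ge_prod a I J : a \in faces X ->
  [disjoint I & J] -> [disjoint typ X a & I] -> [disjoint typ X a & J] ->
  J != finset.set0 ->
  variance_ge P a J I (\prod_(0 <= p < #|I|) \prod_(0 <= q < #|J|)
    (1 - eps (#|a| + p + q)%N ^+ 2)).
Proof.
move=> aX + + aJ J0; move: {2}#|I| (erefl #|I|) => m.
elim: m I => [|m IH] I Im IJ aI.
  by rewrite (cards0_eq Im) cards0 big_nil; apply: variance_ge_set0.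
have /set0Pn[i iI] : I != finset.set0 by rewrite -card_gt0 Im.
have Km : #|I :\ i| = m by move: Im; rewrite (cardsD1 i) iI => -[].
have aK : [disjoint typ X a & I :\ i] by apply: disjointWr aI; apply: subD1set.
have KJ : [disjoint I :\ i & J] by apply: disjointWl IJ; apply: subD1set.
have an : (#|a| + (m.+1 + #|J|) <= n)%N.
  have := @card_typ_le _ _ _ a (I :|: J) aX.
  rewrite cardsU disjoint_setI0 // cards0 subn0 Im; apply.
  by rewrite disjoint_sym disjoint_setU disjoint_sym aI disjoint_sym.
have c01 : 0 <= \prod_(0 <= q < #|J|) (1 - eps (#|a| + m + q)%N ^+ 2) <= 1.
  apply: prodr_itv => q qJ; apply: eps_sqr_itv; apply: leq_trans an.
  by rewrite -!addnA !leq_add2l addn2 addSnnS leq_add2l.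
rewrite Im big_nat_recr //= -{1}(setD1K iI) setUC; apply: variance_geU => //.
- by case/andP: c01.
- by rewrite -Km; apply: IH.
move=> t tl; have [tK atX] := link_facesP tl.
have atm := card_link aX aK tl; rewrite Km in atm.
(* Exchanging the roles of [J] and [i] reduces the last revealed side to [variance_ge1] in the link
   of [a :|: t], whose product is the row [p = m]. *)
apply: variance_geC => //; first by case/andP: c01.
rewrite -atm; apply: variance_ge1 => //.
- by rewrite typU tK !inE eqxx orbF (disjointFl aI iI).
- by rewrite (disjointFr IJ iI).
- by rewrite typU tK disjoint_setU aJ.
Qed.

Lemma sigma2_sqr_le_prod a I J : a \in faces X -> J != finset.set0 ->
  [disjoint I & J] -> [disjoint typ X a & I] -> [disjoint typ X a & J] ->
  sigma2 P a I J ^+ 2 <= 1 - \prod_(0 <= p < #|I|) \prod_(0 <= q < #|J|)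
    (1 - eps (#|a| + p + q)%N ^+ 2).
Proof.
move=> aX J0 IJ aI aJ.
have an : (#|a| + (#|I| + #|J|) <= n)%N.
  have := @card_typ_le _ _ _ a (I :|: J) aX.
  rewrite cardsU disjoint_setI0 // cards0 subn0; apply.
  by rewrite disjoint_sym disjoint_setU disjoint_sym aI disjoint_sym.
(* The bound must be nonnegative to cover the case where the supremum is over the empty set. *)
have /andP[_ c1] : 0 <= \prod_(0 <= p < #|I|) \prod_(0 <= q < #|J|)
    (1 - eps (#|a| + p + q)%N ^+ 2) <= 1.
  apply: (@prodr_itv R _ (fun p => \prod_(0 <= q < #|J|)
    (1 - eps (#|a| + p + q)%N ^+ 2))) => p pI.
  apply: (@prodr_itv R _ (fun q => 1 - eps (#|a| + p + q)%N ^+ 2)) => q qJ.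
  apply: eps_sqr_itv; apply: leq_trans an.
  by rewrite -!addnA !leq_add2l addn2 -addSnnS leq_add.
apply: sigma2_sqr_le; rewrite ?subr_ge0 //.
apply: correlation_leC; apply: variance_ge_correlation => //.
exact: variance_ge_prod.
Qed.

End Product.

Theorem theorem3p6 (R : realType) (n : nat) (V : finType)
    (X : partite_complex n V) (P : weighting R X) (eps : nat -> R)
    (eps_le1 : forall k : nat, (k + 2 <= n)%N -> eps k <= 1)
    (P_eps : eps_product P eps) :
  (forall (a : {set V}) (I J : {set 'I_n}),
     a \in faces X ->
     I != set0 -> J != set0 -> [disjoint I & J] ->
     I \subset ~: typ X a -> J \subset ~: typ X a ->
     sigma2 P a I J ^+ 2 <=
       1 - \prod_(0 <= p < #|I|) \prod_(0 <= q < #|J|)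
             (1 - eps (#|a| + p + q)%N ^+ 2))
  /\
  (forall I J : {set 'I_n},
     I != set0 -> J != set0 -> [disjoint I & J] ->
     eps_walk P I J ^+ 2 <=
       1 - \prod_(0 <= p < #|I|) \prod_(0 <= q < #|J|)
             (1 - eps (n - #|I| - #|J| + p + q)%N ^+ 2)).

Proof.
have part1 (a : {set V}) (I J : {set 'I_n}) : a \in faces X -> J != finset.set0 -> [disjoint I & J] ->
    I \subset ~: typ X a -> J \subset ~: typ X a ->
    sigma2 P a I J ^+ 2 <= 1 - \prod_(0 <= p < #|I|) \prod_(0 <= q < #|J|)
      (1 - eps (#|a| + p + q)%N ^+ 2).
  move=> aX J0 IJ; rewrite -!disjoints_subset ![[disjoint _ & typ X a]]disjoint_sym.
  exact: sigma2_sqr_le_prod.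
split=> [a I J aX _|I J _ J0 IJ]; first exact: part1.
have bound a : a \in faces_of_type X (~: (I :|: J)) ->
    sigma2 P a I J ^+ 2 <= 1 - \prod_(0 <= p < #|I|) \prod_(0 <= q < #|J|)
      (1 - eps (n - #|I| - #|J| + p + q)%N ^+ 2).
  rewrite inE => /andP[aX /eqP ta].
  have <- : #|a| = (n - #|I| - #|J|)%N.
    have := cardsC (I :|: J); rewrite card_ord cardsU disjoint_setI0 // cards0 subn0.
    by move=> nE; rewrite -(card_face aX) ta -subnDA -[X in (X - _)%N]nE addKn.
  by apply: part1 => //; rewrite ta setCK ?subsetUl ?subsetUr.
have [w wX] := exists_facet P.
set s := 1 - _ in bound *.
(* The type complementary to [I :|: J] is attained by a projected facet, and there [s] dominates a
   square. *)
have s0 : 0 <= s.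
  apply: le_trans (sqr_ge0 _) (bound (proj X w (~: (I :|: J))) _).
  by rewrite inE proj_face // typ_proj // eqxx.
(* The interval contains the default value 0 of the maximum, and its lower end allows squaring
   afterwards. *)
have /andP[] : 0 <= eps_walk P I J <= Num.sqrt s.
  rewrite /eps_walk; apply: (big_ind (fun x => 0 <= x <= Num.sqrt s)).
  - by rewrite lexx sqrtr_ge0.
  - by move=> x y /andP[x0 xs] /andP[_ ys]; rewrite le_max x0 ge_max xs ys.
  move=> a at'; have aX : a \in faces X by move: at'; rewrite inE => /andP[].
  by rewrite sigma2_ge0 //= -ler_sqr ?nnegrE ?sqrtr_ge0 ?sigma2_ge0 // sqr_sqrtr ?bound.
by move=> e0 es; rewrite -(sqr_sqrtr s0) ler_sqr ?nnegrE ?sqrtr_ge0.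
Qed.
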